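(* Let $A\in\mathbb{R}^{N\times N}$ be a (nonsingular) $M$-matrix, let $W_1,\dots,W_p$ be the overlapping coordinate subspaces of $\mathbb{R}^N$ with non-overlapping counterparts $\overline{W}_i\subset W_i$ described in the context, and let $q\le p$ be the smallest number of colors such that $W_1,\dots,W_p$ can be colored so that whenever $i\ne j$ and $W_i\cap W_j\neq\{0\}$, $W_i$ and $W_j$ have different colors. For each $i=1,\dots,p$ let $D_i^r,D_i^c$ be diagonal matrices with positive diagonal entries, let $\mu>0$, and put $$\mathcal{A}_i=\mu D_i^rA_iD_i^c,\qquad \tilde{\mathcal{A}}_i=\mathrm{round}_{Mmtrx}(\mathcal{A}_i,u_\ell),\qquad \mathtt{F}_i=\tilde{\mathcal{A}}_i-\mathcal{A}_i,\qquad \tilde{A}_i=\mu^{-1}(D_i^r)^{-1}\tilde{\mathcal{A}}_i(D_i^c)^{-1},$$ where $A_i=R_iAR_i^T$ and $\mathrm{round}_{Mmtrx}(\cdot,u_\ell)$ is the sign-informed rounding to the lower precision $u_\ell$ defined in the context. Assume that for every $i=1,\dots,p$ $$\rho(\mathcal{A}_i^{-1}\mathtt{F}_i)<1\qquad\text{and}\qquad \mathcal{A}_i^{-1}\ \ge\ \mathcal{A}_i^{-1}\mathtt{F}_i\mathcal{A}_i^{-1}\ \text{ (entrywise)}.$$ Let $\tilde{T}_{AS,\theta}$, $\tilde{T}_{RAS}$, $\tilde{T}_{MS}$ be the iteration matrices of the multiprecision damped additive, restricted additive and multiplicative Schwarz methods, obtained by replacing each $A_i^{-1}$ by $\tilde{A}_i^{-1}$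 (formulas in the context). Then $$\rho(\tilde{T}_{MS})<1,\qquad \rho(\tilde{T}_{RAS})<1,\qquad\text{and}\qquad \rho(\tilde{T}_{AS,\theta})<1\ \text{ for every } 0<\theta<1/q,$$ i.e. the multiprecision versions of these Schwarz methods are convergent.
   Context: Inequalities between matrices are entrywise; $\rho(\cdot)$ denotes spectral radius. A matrix $A\in\mathbb{R}^{N\times N}$ is a (nonsingular) $M$-matrix if it is nonsingular, its off-diagonal entries are non-positive, and $A^{-1}\ge 0$. Subspaces and restrictions. $\overline{W}_1,\dots,\overline{W}_p$ are subspaces of $\mathbb{R}^N$, each spanned by a subset of the standard basis vectors, with $\mathbb{R}^N=\sum_i\overline{W}_i$ and $\overline{W}_i\cap\overline{W}_j=\{0\}$ for $i\ne j$ (so they correspond to a partition of $\{1,\dots,N\}$). $W_i\supset\overline{W}_i$ are (larger) subspaces, also each spanned by standard basis vectors; $N_i=\dim W_i\ge\overline{N}_i=\dim\overline{W}_i$ and $\sum_iN_i>N$. $R_i\in\mathbb{R}^{N_i\times N}$ is the zero-one restriction matrix $[I_{N_i}\ 0]\Pi_i$ ($\Pi_i$ a permutation matrix) whose rows are the (transposed) standard basis vectors spanning $W_i$; likewise $\overline{R}_i\in\mathbb{R}^{\overline{N}_i\times N}$ for $\overline{W}_i$. Thus $R_i^TR_i$ and $\overline{R}_i^T\overline{R}_i$ are the orthogonal coordinate projections onto $W_i$ and $\overline{W}_i$. The subdomain matrices are $A_i=R_iAR_i^T\in\mathbb{R}^{N_i\times N_i}$. Rounding. A precision $u_\ell$ comes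 with a set of representable real numbers, containing $0$ and symmetric about $0$. $\mathtt{rd}_{u_\ell}(x)$ rounds $x$ towards zero: for $x>0$ it is the largest representable number $\le x$, and for $x<0$ the smallest representable number $\ge x$. $\mathtt{ru}_{u_\ell}(x)$ rounds $x$ away from zero (towards plus/minus infinity): for $x>0$ it is the smallest representable number $\ge x$, and for $x<0$ the largest representable number $\le x$. It is assumed that the scaled matrices $\mathcal{A}_i$ have entries within the range of the precision, so these roundings are defined (no overflow). For a matrix $X$, $$(\mathrm{round}_{Mmtrx}(X,u_\ell))_{mn}=\begin{cases}\mathtt{ru}_{u_\ell}(X_{mn}),&X_{mn}>0,\\ \mathtt{rd}_{u_\ell}(X_{mn}),&X_{mn}<0,\\ 0,&X_{mn}=0.\end{cases}$$ The effect of the lower precision is modelled solely by replacing $A_i^{-1}$ with $\tilde{A}_i^{-1}$; everything else is in exact arithmetic. Iteration matrices. With $I_N$ the identity, $$\tilde{T}_{AS,\theta}=I_N-\theta\sum_{i=1}^pR_i^T\tilde{A}_i^{-1}R_iA,\qquad \tilde{T}_{RAS}=I_N-\sum_{i=1}^p\overline{R}_i^T\overline{R}_iR_i^T\tilde{A}_i^{-1}R_iA,$$ $$\tilde{T}_{MS}=(I_N-R_p^T\tilde{A}_p^{-1}R_pA)(I_N-R_{p-1}^T\tilde{A}_{p-1}^{-1}R_{p-1}A)\cdots(I_N-R_1^T\tilde{A}_1^{-1}R_1A).$$ *)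

(* Defs.v *)
From HB Require Import structures.
From mathcomp Require Import all_boot all_order all_fingroup all_algebra.
From mathcomp Require Import classical_sets reals.
From mathcomp Require Import complex.

Set Implicit Arguments.
Unset Strict Implicit.
Unset Printing Implicit Defensive.

Import Order.TTheory GRing.Theory Num.Theory.
Local Open Scope classical_set_scope.
Local Open Scope ring_scope.

Definition mx_le (R : realType) (m n : nat) (X Y : 'M[R]_(m, n)) : Prop :=
  forall i j, X i j <= Y i j.

(* The set is finite, so [sup] is a maximum, except when n = 0, where
   sup set0 = 0.  On R[i], `|z| is the modulus as an element of R[i], whence the
   outer [Re]. *)
Definition spectral_radius (R : realType) (n : nat) (X : 'M[R]_n) : R :=
  sup [set complex.Re `|z| |
        z in [set z : R[i] | eigenvalue (map_mx (real_complex R) X) z]].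

Definition M_matrix (R : realType) (n : nat) (A : 'M[R]_n) : Prop :=
  [/\ A \in unitmx,
      forall i j, i != j -> A i j <= 0
    & mx_le 0 (invmx A)].

Definition posdiag_mx (R : realType) (n : nat) (D : 'M[R]_n) : Prop :=
  is_diag_mx D /\ forall k, 0 < D k k.

Definition coordinate_subspace (R : realType) (N : nat)
    (V : {vspace 'cV[R]_N}) : Prop :=
  exists S : {set 'I_N}, V = <<[seq delta_mx j 0%R | j <- enum S]>>%VS.

(* [pid_mx (\dim V)] is here the block matrix [I 0] with \dim V rows and N
   columns.  The permutation, i.e. the order of the rows, is arbitrary. *)
Definition is_restriction_mx (R : realType) (N : nat) (V : {vspace 'cV[R]_N})
    (Rm : 'M[R]_(\dim V, N)) : Prop :=
  (exists s : 'S_N, Rm = pid_mx (\dim V) *m perm_mx s) /\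
  V = <<[seq (row k Rm)^T | k <- enum 'I_(\dim V)]>>%VS.

Definition colorable (R : realType) (N p : nat)
    (W : 'I_p -> {vspace 'cV[R]_N}) (q : nat) : Prop :=
  exists c : 'I_p -> 'I_q,
    forall i j, i != j -> (W i :&: W j)%VS <> 0%VS -> c i <> c j.

Definition min_colors (R : realType) (N p : nat)
    (W : 'I_p -> {vspace 'cV[R]_N}) (q : nat) : Prop :=
  colorable W q /\ forall k : nat, colorable W k -> (q <= k)%N.

Definition precision (R : realType) (F : set R) : Prop :=
  F 0 /\ forall x, F x -> F (- x).

Definition greatest (R : realType) (S : set R) : set R := S `&` ubound S.
Definition least (R : realType) (S : set R) : set R := S `&` lbound S.

(* [rd_set F x] and [ru_set F x] have at most one element: the rounding of x,
   if it is defined. *)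
Definition rd_set (R : realType) (F : set R) (x : R) : set R :=
  if 0 < x then greatest (F `&` [set y | y <= x])
  else if x < 0 then least (F `&` [set y | x <= y])
  else [set 0].

Definition ru_set (R : realType) (F : set R) (x : R) : set R :=
  if 0 < x then least (F `&` [set y | x <= y])
  else if x < 0 then greatest (F `&` [set y | y <= x])
  else [set 0].

Definition rd (R : realType) (F : set R) (x : R) : R := xget 0 (rd_set F x).
Definition ru (R : realType) (F : set R) (x : R) : R := xget 0 (ru_set F x).

(* For a finite precision F, this says that |x| is at most the largest element of F. *)
Definition in_range (R : realType) (F : set R) (x : R) : Prop :=
  rd_set F x !=set0 /\ ru_set F x !=set0.

Definition round_Mmtrx (R : realType) (F : set R) (m n : nat)
    (X : 'M[R]_(m, n)) : 'M[R]_(m, n) :=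
  \matrix_(i, j) if 0 < X i j then ru F (X i j)
                 else if X i j < 0 then rd F (X i j)
                 else 0.

(* The matrices B i below are the (approximate) subdomain matrices whose
   inverses define the local solves. *)
Definition T_AS (R : realType) (N p : nat) (n : 'I_p -> nat) (A : 'M[R]_N)
    (Rm : forall i, 'M[R]_(n i, N)) (B : forall i, 'M[R]_(n i))
    (theta : R) : 'M[R]_N :=
  1%:M - theta *: \sum_(i < p) ((Rm i)^T *m invmx (B i) *m Rm i *m A).

Definition T_RAS (R : realType) (N p : nat) (n nb : 'I_p -> nat) (A : 'M[R]_N)
    (Rm : forall i, 'M[R]_(n i, N)) (Rb : forall i, 'M[R]_(nb i, N))
    (B : forall i, 'M[R]_(n i)) : 'M[R]_N :=
  1%:M - \sum_(i < p)
           ((Rb i)^T *m Rb i *m (Rm i)^T *m invmx (B i) *m Rm i *m A).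

(* [rev_ord] puts the factor of the last subdomain leftmost. *)
Definition T_MS (R : realType) (N p : nat) (n : 'I_p -> nat) (A : 'M[R]_N)
    (Rm : forall i, 'M[R]_(n i, N)) (B : forall i, 'M[R]_(n i)) : 'M[R]_N :=
  \big[mulmx/1%:M]_(k < p)
    let i := rev_ord k in
    (1%:M - (Rm i)^T *m invmx (B i) *m Rm i *m A).

(* Main.v *)
Require Import Defs.
From mathcomp Require Import all_boot all_order perm all_algebra.
From mathcomp Require Import classical_sets reals complex.
Set Implicit Arguments.
Unset Strict Implicit.
Unset Printing Implicit Defensive.
Import Order.TTheory GRing.Theory Num.Theory.
Local Open Scope ring_scope.

(** Everything is measured against one positive vector x with A x > 0, namely
x = A^-1 1. For a nonnegative matrix T, the inequality T x < x forces
rho(T) < 1 ([spectral_radius_lt1]), so each method only needs a nonnegative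
iteration matrix that strictly decreases x.

Rounding moves positive entries up and negative entries towards zero, so
the rounded block Bt, scaled back, dominates A_i entrywise and keeps
nonpositive off-diagonal entries ([rounded_block]). Restricting x to W_i gives
A_i x_i >= (A x)_i > 0, because dropping the other columns only discards
nonpositive terms; hence Bt x_i > 0 as well, and a matrix with nonpositive
off-diagonal entries which maps some positive vector to a positive vector is
an M-matrix ([Z_matrix_M_matrix]). In particular Bt^-1 exists and is
nonnegative.

Let M_i = R_i^T Bt^-1 R_i A. On the rows in W_i the factor I - M_i is
Bt^-1 (Bt R_i - R_i A), a product of nonnegative matrices; on the other rows it
is the identity. Moreover M_i x is positive on W_i and zero elsewhere. These
three facts, packaged as [local_solve] and proved in [restriction_local_solve],
are all that the global arguments use:

- in the multiplicative sweep, the i-th factor lowers x strictly on W_i and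
  leaves the other coordinates alone, so after the whole sweep every coordinate
  is strictly smaller;
- in the restricted additive method, row k of the iteration matrix is row k of
  I - M_i for the unique i such that k lies in the non-overlapping part of W_i;
- in the damped additive method, row k only sees the subspaces that contain
  the k-th basis vector. These meet pairwise, so they have distinct colors and
  there are at most q of them, and theta < 1/q keeps the row nonnegative. *)

(** * Nonnegative matrices and the spectral radius *)

Lemma mulmx_ge0 (R : realType) (m n r : nat) (P : 'M[R]_(m, n))
    (Y : 'M[R]_(n, r)) :
  mx_le 0 P -> mx_le 0 Y -> mx_le 0 (P *m Y).
Proof.
move=> P0 Y0 i j; rewrite !mxE; apply: sumr_ge0 => k _.
by apply: mulr_ge0; [have := P0 i k | have := Y0 k j]; rewrite mxE.
Qed.

Lemma ler_mulmx (R : realType) (m n r : nat) (P : 'M[R]_(m, n))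
    (X Y : 'M[R]_(n, r)) :
  mx_le 0 P -> mx_le X Y -> mx_le (P *m X) (P *m Y).
Proof.
move=> P0 XY i j; rewrite !mxE; apply: ler_sum => k _.
by apply: ler_wpM2l (XY k j); have := P0 i k; rewrite mxE.
Qed.

Lemma mx1_ge0 (R : realType) (n : nat) : mx_le 0 (1%:M : 'M[R]_n).
Proof. by move=> i j; rewrite !mxE ler0n. Qed.

Definition mx_pos (R : realType) (n : nat) (x : 'cV[R]_n) : Prop :=
  forall k, 0 < x k 0.

(** A left eigenvector v for z satisfies |z| |v| <= |v| T entrywise. Pairing with
x gives |z| (|v| x) <= |v| (T x) <= c (|v| x) with |v| x > 0, hence |z| <= c, where
c < 1 is the largest ratio (T x)_k / x_k. *)
Lemma spectral_radius_lt1 (R : realType) (n : nat) (T : 'M[R]_n)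
    (x : 'cV[R]_n) :
  mx_le 0 T -> mx_pos x -> (forall k, (T *m x) k 0 < x k 0) ->
  spectral_radius T < 1.
Proof.
move=> T0 x0 Tx.
pose c : R := \big[Order.max/0]_k ((T *m x) k 0 / x k 0).
have c1 : c < 1.
  apply/bigmax_ltP; split=> [|k _]; first exact: ltr01.
  by rewrite ltr_pdivrMr // mul1r.
have Tcx k : (T *m x) k 0 <= c * x k 0.
  rewrite -ler_pdivrMr //.
  exact: (le_bigmax 0 (fun k => (T *m x) k 0 / x k 0)).
have ub : ubound [set complex.Re `|z| |
    z in [set z : R[i] | eigenvalue (map_mx (real_complex R) T) z]]%classic c.
  move=> _ [z /eigenvalueP[v vT v0] <-].
  suff : `|z| <= real_complex R c by rewrite lecE => /andP[].
  pose w := \sum_k `|v 0 k| * real_complex R (x k 0).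
  have w0 : 0 < w.
    have [k vk] : exists k, v 0 k != 0.
      apply/existsP; apply: contraNT v0; rewrite negb_exists => /forallP v0.
      by apply/eqP/rowP => k; rewrite mxE; apply/eqP; have := v0 k; rewrite negbK.
    rewrite /w (bigD1 k) //= ltr_pwDl //.
      by rewrite mulr_gt0 ?normr_gt0 // ltcR.
    by apply: sumr_ge0 => l _; rewrite mulr_ge0 // lecR ltW.
  (* Both sides are multiplied by w, the pairing of |v| with x. *)
  rewrite -(ler_pM2r w0) /w !mulr_sumr.
  apply: (@le_trans _ _ (\sum_k \sum_l
      `|v 0 l| * real_complex R (T l k) * real_complex R (x k 0))).
    apply: ler_sum => k _; rewrite mulrA -normrM -mulr_suml.
    apply: ler_wpM2r; first by rewrite lecR ltW.
    have -> : z * v 0 k = (z *: v) 0 k by rewrite mxE.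
    rewrite -vT mxE; apply: le_trans (ler_norm_sum _ _ _) _.
    apply: ler_sum => l _; rewrite normrM mxE [`|real_complex R _|]ger0_norm //.
    by rewrite lecR; have := T0 l k; rewrite mxE.
  rewrite exchange_big; apply: ler_sum => l _ /=.
  rewrite mulrCA.
  under eq_bigr do rewrite -mulrA.
  rewrite -mulr_sumr; apply: ler_wpM2l => //.
  have := Tcx l; rewrite mxE -lecR rmorph_sum rmorphM /=.
  by under eq_bigr do rewrite rmorphM /=.
rewrite /spectral_radius; set E := (X in sup X) in ub *.
(* There is no eigenvalue when n = 0, and then the supremum is 0. *)
have [->|/set0P E0] := eqVneq E set0; first by rewrite sup0 ltr01.
by apply: le_lt_trans c1; apply: ge_sup.
Qed.

Lemma spectral_radius_sub_lt1 (R : realType) (N : nat) (x : 'cV[R]_N)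
    (C : 'M[R]_N) :
  mx_le 0 (1%:M - C) -> mx_pos x -> mx_pos (C *m x) ->
  spectral_radius (1%:M - C) < 1.
Proof.
move=> T0 x0 Cx0; apply: spectral_radius_lt1 T0 x0 _ => k.
by rewrite mulmxBl mul1mx [ltLHS]mxE [X in _ + X]mxE gtrDl oppr_lt0 Cx0.
Qed.

(** * Matrices with nonpositive off-diagonal entries *)

Definition Z_matrix (R : realType) (n : nat) (B : 'M[R]_n) : Prop :=
  forall i j, i != j -> B i j <= 0.

(** Compare a column y of Y with t x, where t is the smallest ratio y_k / x_k.
At a minimizing index k, the off-diagonal signs give (B y)_k <= t (B x)_k, so
t < 0 would make (B y)_k negative. *)
Lemma Z_matrix_monotone (R : realType) (n m : nat) (B : 'M[R]_n)
    (x : 'cV[R]_n) (Y : 'M[R]_(n, m)) :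
  Z_matrix B -> mx_pos x -> mx_pos (B *m x) ->
  mx_le 0 (B *m Y) -> mx_le 0 Y.
Proof.
move=> ZB x0 Bx0 BY0 k0 j; rewrite mxE leNgt; apply/negP => Yk0.
pose r k := Y k j / x k 0.
case: (@Order.TotalTheory.arg_minP _ R _ k0 xpredT r) => // k _ kmin.
set t := r k in kmin.
have t0 : t < 0.
  by apply: le_lt_trans (kmin k0 isT) _; rewrite pmulr_llt0 // invr_gt0 x0.
have tx l : t * x l 0 <= Y l j by rewrite -ler_pdivlMr // kmin.
have : (B *m Y) k j <= t * (B *m x) k 0.
  rewrite !mxE mulr_sumr; apply: ler_sum => l _; rewrite mulrCA.
  have [<-|kl] := eqVneq k l; first by rewrite divfK // gt_eqF.
  by apply: ler_wnM2l; [apply: ZB|].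
apply/negP; rewrite -ltNge; apply: lt_le_trans (BY0 k j).
by rewrite [ltRHS]mxE pmulr_llt0.
Qed.

Lemma Z_matrix_unit (R : realType) (n : nat) (B : 'M[R]_n) (x : 'cV[R]_n) :
  Z_matrix B -> mx_pos x -> mx_pos (B *m x) -> B \in unitmx.
Proof.
move=> ZB x0 Bx0; rewrite -unitmx_tr -row_free_unit; apply: inj_row_free => v vB.
have Bv : B *m v^T = 0 by rewrite -[B]trmxK -trmx_mul vB trmx0.
have v_ge0 : mx_le 0 v^T by apply: (Z_matrix_monotone ZB x0) => //; rewrite Bv.
have v_le0 : mx_le 0 (- v^T).
  by apply: (Z_matrix_monotone ZB x0) => //; rewrite mulmxN Bv oppr0.
apply/rowP => k; apply/eqP; rewrite eq_le; have := v_ge0 k 0; have := v_le0 k 0.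
by rewrite !mxE oppr_ge0 => -> ->.
Qed.

(** Monotonicity makes B injective, and applied to the columns of B^-1, whose
images under B are the columns of the identity, it gives B^-1 >= 0. *)
Lemma Z_matrix_M_matrix (R : realType) (n : nat) (B : 'M[R]_n) (x : 'cV[R]_n) :
  Z_matrix B -> mx_pos x -> mx_pos (B *m x) -> M_matrix B.
Proof.
move=> ZB x0 Bx0; have uB := Z_matrix_unit ZB x0 Bx0; split=> //.
by apply: (Z_matrix_monotone ZB x0 Bx0); rewrite mulmxV //; apply: mx1_ge0.
Qed.

(** Strictness comes from invertibility: B^-1 has no zero row. *)
Lemma invmx_pos (R : realType) (n : nat) (B : 'M[R]_n) (y : 'cV[R]_n) :
  M_matrix B -> mx_pos y -> mx_pos (invmx B *m y).
Proof.
case=> uB _ B0 y0 k; rewrite lt_def.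
have y_ge0 : mx_le 0 y by move=> i j; rewrite ord1 mxE ltW.
have := mulmx_ge0 B0 y_ge0 k 0; rewrite [X in X <= _]mxE => ->; rewrite andbT.
apply/negP; rewrite mxE psumr_eq0 => [/allP By0|l _]; last first.
  by rewrite mulr_ge0 ?(ltW (y0 l)) //; have := B0 k l; rewrite mxE.
have : (invmx B *m B) k k = 1 by rewrite mulVmx // mxE eqxx.
rewrite mxE big1 => [/eqP|l _]; first by rewrite eq_sym oner_eq0.
have /eqP/eqP := By0 l (mem_index_enum l).
by rewrite mulf_eq0 (gt_eqF (y0 l)) orbF => /eqP->; rewrite mul0r.
Qed.

(** * Coordinate subspaces and restrictions *)

Definition coord_set (R : realType) (N : nat) (V : {vspace 'cV[R]_N}) :
  {set 'I_N} := [set j | delta_mx j 0 \in V].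

(** The injection f lists the basis vectors of V in the order of the rows of the
restriction matrix. It replaces the dimension-indexed permutation in every
later computation. *)
Lemma restriction_mxP (R : realType) (N : nat) (V : {vspace 'cV[R]_N})
    (Rm : 'M[R]_(\dim V, N)) :
  is_restriction_mx Rm ->
  exists f : 'I_(\dim V) -> 'I_N,
    [/\ injective f, Rm = rowsub f 1%:M, coord_set V = [set f k | k : 'I__]
      & forall v j, v \in V -> j \notin coord_set V -> v j 0 = 0].
Proof.
case=> -[s defR] defV.
have leVN : (\dim V <= N)%N.
  by rewrite (leq_trans (dimvS (subvf V))) // dimvf /dim /= muln1.
pose f (k : 'I_(\dim V)) := s (widen_ord leVN k).
have f_inj : injective f by move=> k l /perm_inj [] /val_inj.
have RmE : Rm = rowsub f 1%:M.
  apply/matrixP => k j; rewrite defR !mxE (bigD1 (widen_ord leVN k)) //= big1.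
    by rewrite !mxE eqxx ltn_ord mul1r addr0.
  move=> l lk; rewrite !mxE; case: eqP => [kl|_]; last by rewrite mul0r.
  by case/eqP: lk; apply: val_inj.
have rowRm k : (row k Rm)^T = delta_mx (f k) 0.
  by rewrite RmE; apply/matrixP => i j; rewrite !mxE ord1 eqxx andbT eq_sym.
have V0 v j : v \in V -> j \notin [set f k | k : 'I__] -> v j 0 = 0.
  move=> vV jf; move: vV; rewrite {1}defV => /coord_span ->.
  rewrite summxE big1 // => i _.
  rewrite mxE; set u := _`_i.
  have /mapP[k _ ->] : u \in [seq (row k Rm)^T | k <- enum 'I__].
    by apply: mem_nth; rewrite size_tuple.
  rewrite rowRm mxE eqxx andbT; case: eqP => [jk|_]; last by rewrite mulr0.
  by case/negP: jf; apply/imsetP; exists k.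
have sE : coord_set V = [set f k | k : 'I__].
  apply/setP => j; rewrite inE; apply/idP/idP => [jV|/imsetP[k _ ->]].
    apply: contraTT isT => jf; have /eqP := V0 _ _ jV jf.
    by rewrite mxE !eqxx oner_eq0.
  have : (row k Rm)^T \in [seq (row l Rm)^T | l <- enum 'I_(\dim V)].
    by apply: map_f; rewrite mem_enum.
  by move=> /memv_span; rewrite -defV rowRm.
by exists f; split; rewrite ?sE.
Qed.

Lemma rowsub1T_mulE (R : realType) (n N m : nat) (f : 'I_n -> 'I_N)
    (Y : 'M[R]_(n, m)) l j :
  injective f -> ((rowsub f 1%:M)^T *m Y) (f l) j = Y l j.
Proof.
move=> f_inj; rewrite mxE (bigD1 l) //= big1 => [|i il].
  by rewrite !mxE eqxx mul1r addr0.
by rewrite !mxE (inj_eq f_inj) (negPf il) mul0r.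
Qed.

Lemma rowsub1T_mul0 (R : realType) (n N m : nat) (f : 'I_n -> 'I_N)
    (Y : 'M[R]_(n, m)) k j :
  k \notin [set f l | l : 'I_n] -> ((rowsub f 1%:M)^T *m Y) k j = 0.
Proof.
move=> kf; rewrite mxE big1 // => i _; rewrite !mxE.
case: eqP => [fk|_]; last by rewrite mul0r.
by case/negP: kf; apply/imsetP; exists i.
Qed.

(** * The local subdomain solve *)

(** What the convergence arguments need from the correction operator M of one
subdomain S: the corrected iteration I - M is nonnegative, M only updates the
coordinates in S, and it makes strict progress on x there. *)
Definition local_solve (R : realType) (N : nat) (x : 'cV[R]_N)
    (S : {set 'I_N}) (M : 'M[R]_N) : Prop :=
  [/\ mx_le 0 (1%:M - M), forall k j, k \notin S -> M k j = 0
    & forall k, k \in S -> 0 < (M *m x) k 0].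

(** Columns in the range of f compare A with B; on every other column the right
side is zero and the left side is an off-diagonal entry of A. *)
Lemma rowsub_le_extension (R : realType) (n N : nat) (A : 'M[R]_N)
    (f : 'I_n -> 'I_N) (B : 'M[R]_n) :
  Z_matrix A -> injective f ->
  mx_le (rowsub f 1%:M *m A *m (rowsub f 1%:M)^T) B ->
  mx_le (rowsub f A) (B *m rowsub f 1%:M).
Proof.
move=> ZA f_inj AB m j; rewrite mxE.
have -> : (B *m rowsub f 1%:M) m j = \sum_l B m l * (f l == j)%:R.
  by rewrite mxE; apply: eq_bigr => l _; rewrite !mxE.
have [/imsetP[l _ ->]|jf] := boolP (j \in [set f l | l : 'I_n]).
  rewrite (bigD1 l) //= eqxx mulr1 big1 ?addr0 => [|i il]; last first.
    by rewrite (inj_eq f_inj) (negPf il) mulr0.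
  have := AB m l.
  rewrite -rowsubE -[_ *m _]trmxK trmx_mul trmxK [in X in X -> _]mxE.
  by rewrite -rowsubE !mxE.
rewrite big1 => [|l _].
  by apply: ZA; apply: contraNneq jf => <-; apply/imsetP; exists m.
case: eqP => [fj|_]; last by rewrite mulr0.
by case/negP: jf; apply/imsetP; exists l.
Qed.

(** With Q the restriction, the rows of I - Q^T B^-1 Q A in the range of f form
B^-1 (B Q - Q A), so [rowsub_le_extension] gives their sign. The same inequality
applied to x shows that B maps the restriction of x to a positive vector. *)
Lemma restriction_local_solve (R : realType) (N : nat) (A : 'M[R]_N)
    (x : 'cV[R]_N) (V : {vspace 'cV[R]_N}) (Rm : 'M[R]_(\dim V, N))
    (B : 'M[R]_(\dim V)) :
  Z_matrix A -> mx_pos x -> mx_pos (A *m x) -> is_restriction_mx Rm ->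
  Z_matrix B -> mx_le (Rm *m A *m Rm^T) B ->
  local_solve x (coord_set V) (Rm^T *m invmx B *m Rm *m A).
Proof.
move=> ZA x0 Ax0 /restriction_mxP[f [f_inj -> -> _]] ZB AB.
have AQ := rowsub_le_extension ZA f_inj AB.
set Q := rowsub f 1%:M in AQ *.
have QAx0 : mx_pos (rowsub f A *m x).
  by move=> k; rewrite mul_rowsub_mx mxE.
have MB : M_matrix B.
  apply: (Z_matrix_M_matrix (x := rowsub f x)) => // k; first by rewrite mxE.
  apply: lt_le_trans (QAx0 k) _; rewrite [rowsub f x]rowsubE mulmxA !mxE.
  by apply: ler_sum => l _; apply: ler_wpM2r (AQ k l); apply: ltW.
have [uB _ B0] := MB.
have -> : Q^T *m invmx B *m Q *m A = Q^T *m (invmx B *m rowsub f A).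
  by rewrite -!mulmxA -[Q *m A]rowsubE.
split=> [k j|k j kf|_ /imsetP[l _ ->]]; first last.
- by rewrite -mulmxA rowsub1T_mulE // -mulmxA; apply: invmx_pos.
- exact: rowsub1T_mul0.
have [/imsetP[l _ ->]|kf] := boolP (k \in [set f l | l : 'I__]); last first.
  by rewrite [leRHS]mxE [X in _ + X]mxE rowsub1T_mul0 // subr0 !mxE ler0n.
rewrite [leRHS]mxE [X in _ + X]mxE rowsub1T_mulE // mxE subr_ge0.
have := ler_mulmx B0 AQ l j.
by rewrite mulmxA mulVmx // mul1mx [X in _ <= X]mxE.
Qed.

(** * Convergence of the three methods *)

(** Once a coordinate has dropped below x it stays there: a later factor either
leaves it alone or, being nonnegative, bounds it by its own value at x, which
is again below x. *)
Lemma local_solve_sweep (R : realType) (N : nat) (I : eqType) (x : 'cV[R]_N)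
    (S : I -> {set 'I_N}) (M : I -> 'M[R]_N) (s : seq I) :
  mx_pos x -> (forall i, local_solve x (S i) (M i)) ->
  let P := \big[mulmx/1%:M]_(i <- s) (1%:M - M i) in
  [/\ mx_le 0 P, mx_le (P *m x) x
    & forall i k, i \in s -> k \in S i -> (P *m x) k 0 < x k 0].
Proof.
move=> x0 Mx /=; elim: s => [|i s [P0 Px Plt]].
  rewrite big_nil mul1mx; split=> //; exact: mx1_ge0.
rewrite big_cons; set P := \big[_/_]_(_ <- _) _ in P0 Px Plt *.
have [T0 MS Mpos] := Mx i; set T := 1%:M - M i in T0 *.
have Tx k : k \in S i -> (T *m (P *m x)) k 0 < x k 0.
  move=> kS; apply: le_lt_trans (ler_mulmx T0 Px k 0) _.
  rewrite /T mulmxBl mul1mx !mxE gtrDl oppr_lt0.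
  by have := Mpos k kS; rewrite mxE.
have TxN k : k \notin S i -> (T *m (P *m x)) k 0 = (P *m x) k 0.
  move=> kS; rewrite mulmxBl mul1mx [LHS]mxE [X in _ + X]mxE [X in - X]mxE.
  rewrite big1 ?subr0 // => l _; by rewrite MS // mul0r.
rewrite -mulmxA; split=> [|k j|j k].
- exact: mulmx_ge0.
- rewrite ord1; have [/Tx/ltW //|/TxN->] := boolP (k \in S i); exact: Px.
- have [/Tx//|kS] := boolP (k \in S i); rewrite TxN // inE => /orP[/eqP->|].
    by rewrite (negPf kS).
  exact: Plt.
Qed.

Lemma multiplicative_convergent (R : realType) (N p : nat) (x : 'cV[R]_N)
    (S : 'I_p -> {set 'I_N}) (M : 'I_p -> 'M[R]_N) :
  mx_pos x -> (forall i, local_solve x (S i) (M i)) ->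
  (forall k, exists i, k \in S i) ->
  spectral_radius (\big[mulmx/1%:M]_(k < p) (1%:M - M (rev_ord k))) < 1.
Proof.
move=> x0 Mx cov.
rewrite -(big_map (@rev_ord p) xpredT (fun i => 1%:M - M i)).
have [P0 _ Plt] := local_solve_sweep (map (@rev_ord p) (index_enum 'I_p)) x0 Mx.
apply: spectral_radius_lt1 P0 x0 _ => k; have [i ki] := cov k.
apply: Plt ki; apply/mapP; exists (rev_ord i); rewrite ?rev_ordK //.
exact: mem_index_enum.
Qed.

(** Since the sets Sb i partition the coordinates and E i projects onto Sb i, row
k of the sum is row k of the single M i with k in Sb i. *)
Lemma restricted_additive_convergent (R : realType) (N p : nat)
    (x : 'cV[R]_N) (S Sb : 'I_p -> {set 'I_N}) (M E : 'I_p -> 'M[R]_N) :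
  mx_pos x -> (forall i, local_solve x (S i) (M i)) ->
  (forall i, Sb i \subset S i) ->
  (forall k, exists i, k \in Sb i) ->
  (forall i j k, k \in Sb i -> k \in Sb j -> i = j) ->
  (forall i (k l : 'I_N), E i k l = ((k == l) && (k \in Sb i))%:R) ->
  spectral_radius (1%:M - \sum_i (E i *m M i)) < 1.
Proof.
move=> x0 Mx sub cov disj defE; set C := \sum_i _.
have rowC k i j : k \in Sb i -> C k j = M i k j.
  move=> ki; rewrite summxE (bigD1 i) //= [X in _ + X]big1 ?addr0 => [|l li].
    rewrite mxE (bigD1 k) //= big1 ?addr0 => [|m mk].
      by rewrite defE eqxx ki mul1r.
    by rewrite defE eq_sym (negPf mk) mul0r.
  rewrite mxE big1 // => m _; rewrite defE.
  have /negPf-> : k \notin Sb l.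
    by apply: contra li => kl; rewrite (disj _ _ _ kl ki).
  by rewrite andbF mul0r.
apply: (spectral_radius_sub_lt1 (x := x)) => // [k j|k]; have [i ki] := cov k.
  have [T0 _ _] := Mx i; have := T0 k j.
  by rewrite !mxE (rowC k i).
have [_ _ pos] := Mx i; have := pos k (fintype.subsetP (sub i) _ ki).
by rewrite !mxE; under [in X in _ -> X]eq_bigr do rewrite (rowC k i) //.
Qed.

(** At most q of the M i have a nonzero row k, and each has row k at most the
row k of the identity, so theta q <= 1 keeps the row nonnegative. *)
Lemma additive_convergent (R : realType) (N p q : nat) (x : 'cV[R]_N)
    (S : 'I_p -> {set 'I_N}) (M : 'I_p -> 'M[R]_N) (theta : R) :
  mx_pos x -> (forall i, local_solve x (S i) (M i)) ->
  (forall k, exists i, k \in S i) ->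
  (forall k, #|[set i | k \in S i]| <= q)%N ->
  0 < theta -> theta < q%:R^-1 ->
  spectral_radius (1%:M - theta *: \sum_i M i) < 1.
Proof.
move=> x0 Mx cov mult th0 thq.
have q0 : 0 < q%:R :> R by rewrite -invr_gt0; apply: lt_trans thq.
apply: (spectral_radius_sub_lt1 (x := x)) => // [k j|k]; last first.
  have [i ki] := cov k; rewrite -scalemxAl mxE pmulr_rgt0 //.
  rewrite mulmx_suml summxE (bigD1 i) //= ltr_pwDl //.
    by have [_ _] := Mx i; apply.
  apply: sumr_ge0 => l _; have [_ M0 Mpos] := Mx l.
  have [/Mpos/ltW//|kl] := boolP (k \in S l).
  by rewrite mxE big1 // => m _; rewrite M0 // mul0r.
set a := #|[set i | k \in S i]|.
have aq : theta * a%:R <= 1.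
  rewrite -[leRHS](mulVf (lt0r_neq0 q0)).
  by apply: ler_pM; rewrite ?ler0n ?ler_nat ?mult // ltW.
have leM i : M i k j <= (k \in S i)%:R * (k == j)%:R.
  have [T0 M0 _] := Mx i.
  have [_|/M0->] := boolP (k \in S i); last by rewrite mul0r.
  by have := T0 k j; rewrite !mxE subr_ge0 mul1r.
rewrite !mxE summxE subr_ge0.
apply: (@le_trans _ _ (theta * (a%:R * (k == j)%:R))); last first.
  by rewrite mulrA -[leRHS]mul1r ler_wpM2r.
rewrite ler_pM2l //; apply: (le_trans (ler_sum _ (fun i _ => leM i))).
rewrite -mulr_suml -natr_sum /a -sum1_card [in leRHS]big_mkcond /=.
by under [in leRHS]eq_bigr do rewrite inE.
Qed.

(** * Sign-informed rounding and diagonal scaling *)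

Lemma le_round_Mmtrx (R : realType) (F : set R) (m n : nat)
    (X : 'M[R]_(m, n)) :
  (forall i j, in_range F (X i j)) -> mx_le X (round_Mmtrx F X).
Proof.
move=> rX i j; rewrite mxE; have [ex_rd ex_ru] := rX i j.
case: ifP => [X0|/negbT X0].
  have : ru_set F (X i j) (ru F (X i j)) by exact: xgetPex.
  by rewrite /ru_set X0 => -[[_ Xle] _]; exact: Xle.
case: ifP => [Xlt0|/negbT XN0]; last by rewrite leNgt.
have : rd_set F (X i j) (rd F (X i j)) by exact: xgetPex.
by rewrite /rd_set (negPf X0) Xlt0 => -[[_ Xle] _]; exact: Xle.
Qed.

(** A negative entry cannot be rounded past zero, because zero is representable. *)
Lemma round_Mmtrx_Z (R : realType) (F : set R) (n : nat) (X : 'M[R]_n) :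
  precision F -> (forall i j, in_range F (X i j)) ->
  Z_matrix X -> Z_matrix (round_Mmtrx F X).
Proof.
move=> [F0 _] rX ZX i j ij; rewrite mxE ltNge ZX //=.
case: ifP => [X0|//]; have [ex_rd _] := rX i j.
have : rd_set F (X i j) (rd F (X i j)) by exact: xgetPex.
rewrite /rd_set ltNge ZX //= X0 => -[_]; apply.
by split=> //=; apply: ZX.
Qed.

Lemma scale_mxE (R : realType) (n : nat) (mu : R) (D1 D2 X : 'M[R]_n) i j :
  posdiag_mx D1 -> posdiag_mx D2 ->
  (mu *: (D1 *m X *m D2)) i j = mu * D1 i i * D2 j j * X i j.
Proof.
move=> [/diag_mxP[d1 ->] _] [/diag_mxP[d2 ->] _].
by rewrite mul_diag_mx mul_mx_diag !mxE !eqxx !mulr1n -!mulrA [X i j * _]mulrC.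
Qed.

Lemma invmx_posdiag (R : realType) (n : nat) (D : 'M[R]_n) :
  posdiag_mx D -> posdiag_mx (invmx D) /\ forall i, invmx D i i = (D i i)^-1.
Proof.
case=> /diag_mxP[d ->] d0.
have {}d0 k : 0 < d 0 k by have := d0 k; rewrite mxE eqxx.
pose e := \row_k (d 0 k)^-1.
have DE : diag_mx d *m diag_mx e = 1%:M.
  apply/matrixP => i j; rewrite mul_diag_mx !mxE mulrnAr.
  by case: eqP => // _; rewrite mulfV // gt_eqF.
have [uD _] := mulmx1_unit DE.
have -> : invmx (diag_mx d) = diag_mx e.
  by rewrite -[RHS]mul1mx -(mulVmx uD) -mulmxA DE mulmx1.
split=> [|i]; last by rewrite !mxE eqxx.
by split=> [|k]; rewrite ?diag_mx_is_diag // !mxE eqxx mulr1n invr_gt0.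
Qed.

(** Scaling by positive diagonal matrices multiplies each entry by a positive
number, and scaling back divides by the same number, so signs and entrywise
comparisons of the scaled and rounded matrix carry over to the block. *)
Lemma rounded_block (R : realType) (n : nat) (F : set R) (mu : R)
    (Dr Dc B : 'M[R]_n) :
  let Bsc := mu *: (Dr *m B *m Dc) in
  let Bt := mu^-1 *: (invmx Dr *m round_Mmtrx F Bsc *m invmx Dc) in
  precision F -> 0 < mu -> posdiag_mx Dr -> posdiag_mx Dc ->
  (forall i j, in_range F (Bsc i j)) ->
  Z_matrix B -> Z_matrix Bt /\ mx_le B Bt.
Proof.
move=> Bsc Bt hF mu0 hDr hDc rB ZB.
have [iDr iDrE] := invmx_posdiag hDr; have [iDc iDcE] := invmx_posdiag hDc.
have w0 i j : 0 < mu * Dr i i * Dc j j.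
  by have [_ r0] := hDr; have [_ c0] := hDc; rewrite !mulr_gt0.
have BscE i j : Bsc i j = mu * Dr i i * Dc j j * B i j by rewrite scale_mxE.
have BtE i j : Bt i j = (mu * Dr i i * Dc j j)^-1 * round_Mmtrx F Bsc i j.
  by rewrite scale_mxE // iDrE iDcE !invfM.
have ZBsc : Z_matrix Bsc by move=> i j /ZB; rewrite BscE pmulr_rle0.
split=> [i j ij|i j].
  by rewrite BtE pmulr_rle0 ?invr_gt0 //; apply: round_Mmtrx_Z.
by rewrite BtE ler_pdivlMl // -BscE; apply: le_round_Mmtrx.
Qed.

(** * Overlap, covering and colors *)

Lemma restriction_Z (R : realType) (N : nat) (A : 'M[R]_N)
    (V : {vspace 'cV[R]_N}) (Rm : 'M[R]_(\dim V, N)) :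
  Z_matrix A -> is_restriction_mx Rm -> Z_matrix (Rm *m A *m Rm^T).
Proof.
move=> ZA /restriction_mxP[f [f_inj -> _ _]] i j ij.
rewrite -rowsubE -[_ *m _]trmxK trmx_mul trmxK -rowsubE !mxE.
by apply: ZA; rewrite (inj_eq f_inj).
Qed.

Lemma restriction_projE (R : realType) (N : nat) (V : {vspace 'cV[R]_N})
    (Rm : 'M[R]_(\dim V, N)) k l :
  is_restriction_mx Rm ->
  (Rm^T *m Rm) k l = ((k == l) && (k \in coord_set V))%:R.
Proof.
move=> /restriction_mxP[f [f_inj -> -> _]].
have [/imsetP[m _ ->]|kf] := boolP (k \in [set f k | k : 'I__]).
  by rewrite rowsub1T_mulE // !mxE andbT.
by rewrite rowsub1T_mul0 // andbF.
Qed.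

Lemma coord_set_meet (R : realType) (N : nat) (V W : {vspace 'cV[R]_N}) k :
  k \in coord_set V -> k \in coord_set W -> (V :&: W)%VS <> 0%VS.
Proof.
rewrite !inE => kV kW VW0.
have : delta_mx k 0 \in (V :&: W)%VS by rewrite memv_cap kV.
rewrite VW0 memv0 => /eqP/matrixP/(_ k 0)/eqP.
by rewrite !mxE !eqxx oner_eq0.
Qed.

(** Otherwise every vector of the sum would have a zero k-th coordinate. *)
Lemma coord_set_cover (R : realType) (N p : nat) (V : 'I_p -> {vspace 'cV[R]_N})
    (Rm : forall i, 'M[R]_(\dim (V i), N)) k :
  (forall i, is_restriction_mx (Rm i)) -> (\sum_(i < p) V i)%VS = fullv ->
  exists i, k \in coord_set (V i).
Proof.
move=> hRm sumV; apply/existsP; apply: contraT.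
rewrite negb_exists => /forallP kV.
have /memv_sumP[v vV kE] : delta_mx k 0 \in (\sum_(i < p) V i)%VS.
  by rewrite sumV memvf.
have /matrixP/(_ k 0)/eqP := kE.
rewrite summxE big1 => [|i _]; first by rewrite mxE !eqxx oner_eq0.
have [f [_ _ _ V0]] := restriction_mxP (hRm i).
by apply: V0 (kV i); apply: vV.
Qed.

(** Subspaces sharing a basis vector meet, so a coloring is injective on them. *)
Lemma colorable_multiplicity (R : realType) (N p q : nat)
    (V : 'I_p -> {vspace 'cV[R]_N}) k :
  colorable V q -> (#|[set i | k \in coord_set (V i)]| <= q)%N.
Proof.
case=> c cP; rewrite -[leqRHS]card_ord; apply: (@leq_card_in _ _ c) => i j.
rewrite inE => ki; rewrite inE => kj cij; apply/eqP; apply: contraPT cij => ij.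
exact: cP ij (coord_set_meet ki kj).
Qed.

Local Open Scope classical_set_scope.

Theorem theorem3 (R : realType) (N p q : nat) (A : 'M[R]_N)
  (W Wb : 'I_p -> {vspace 'cV[R]_N})
  (Rm : forall i, 'M[R]_(\dim (W i), N))
  (Rb : forall i, 'M[R]_(\dim (Wb i), N))
  (F : set R) (mu : R) (Dr Dc : forall i, 'M[R]_(\dim (W i)))
  (hA : M_matrix A)
  (hWb : forall i, coordinate_subspace (Wb i))
  (hWb_sum : (\sum_(i < p) Wb i)%VS = fullv)
  (hWb_cap : forall i j, i != j -> (Wb i :&: Wb j)%VS = 0%VS)
  (hW : forall i, coordinate_subspace (W i))
  (hWbW : forall i, (Wb i <= W i)%VS)
  (hoverlap : (N < \sum_(i < p) \dim (W i))%N)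
  (hRm : forall i, is_restriction_mx (Rm i))
  (hRb : forall i, is_restriction_mx (Rb i))
  (hq : min_colors W q)
  (hF : precision F)
  (hmu : 0 < mu)
  (hDr : forall i, posdiag_mx (Dr i))
  (hDc : forall i, posdiag_mx (Dc i)) :
  let Asub i := Rm i *m A *m (Rm i)^T in
  let Asc i := mu *: (Dr i *m Asub i *m Dc i) in
  let Asct i := round_Mmtrx F (Asc i) in
  let Err i := Asct i - Asc i in
  let At i := mu^-1 *: (invmx (Dr i) *m Asct i *m invmx (Dc i)) in
  (forall i m n, in_range F (Asc i m n)) ->
  (forall i, spectral_radius (invmx (Asc i) *m Err i) < 1) ->
  (forall i, mx_le (invmx (Asc i) *m Err i *m invmx (Asc i))
                   (invmx (Asc i))) ->
  [/\ spectral_radius (T_MS A Rm At) < 1,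
      spectral_radius (T_RAS A Rm Rb At) < 1
    & forall theta : R, 0 < theta -> theta < q%:R^-1 ->
        spectral_radius (T_AS A Rm At theta) < 1].
Proof.
move=> Asub Asc Asct Err At rAsc _ _.
have [uA ZA _] := hA.
pose x : 'cV[R]_N := invmx A *m const_mx 1.
have y0 : mx_pos (const_mx 1 : 'cV[R]_N) by move=> k; rewrite mxE ltr01.
have x0 : mx_pos x by apply: invmx_pos.
have Ax0 : mx_pos (A *m x) by rewrite mulKVmx.
have covb k := coord_set_cover k hRb hWb_sum.
have sub i : (coord_set (Wb i) \subset coord_set (W i))%N.
  by apply/fintype.subsetP => k; rewrite !inE; apply: (subvP (hWbW i)).
have cov k : exists i, k \in coord_set (W i).
  by have [i ki] := covb k; exists i; apply: (fintype.subsetP (sub i)).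
pose M i := (Rm i)^T *m invmx (At i) *m Rm i *m A.
have local i : local_solve x (coord_set (W i)) (M i).
  have [ZAt leAt] := rounded_block hF hmu (hDr i) (hDc i) (rAsc i)
                                   (restriction_Z ZA (hRm i)).
  exact: restriction_local_solve.
split=> [||theta th0 thq].
- exact: multiplicative_convergent local cov.
- have -> : T_RAS A Rm Rb At =
             1%:M - \sum_i ((Rb i)^T *m Rb i *m M i).
    by rewrite /T_RAS /M; under [in RHS]eq_bigr do rewrite !mulmxA.
  apply: (restricted_additive_convergent x0 local sub covb) => [i j k ki kj|i k l].
    by apply/eqP; apply/negPn/negP => /hWb_cap; apply: coord_set_meet ki kj.
  exact: restriction_projE.
- apply: (additive_convergent x0 local cov _ th0 thq) => k.
  by apply: colorable_multiplicity; case: hq.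
Qed.
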